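(* Let $m,n\ge 1$ and let $\pi : \mathrm{Hom}(F_n/\Gamma^3_n,U(m)) \to \mathrm{Rep}(F_n/\Gamma^3_n,U(m))$ denote the quotient map. Then the inclusion $\bigcup_{\mathbf{a}\vdash m}B_n(U(\mathbf{a}),Z_{\mathbf{a}})\subset \mathrm{Hom}(F_n/\Gamma^3_n,U(m))$ is surjective upon passing to orbits, that is, \[\pi\left(\bigcup_{\mathbf{a}\vdash m}B_n(U(\mathbf{a}),Z_{\mathbf{a}})\right) = \mathrm{Rep}(F_n/\Gamma^3_n,U(m)).\]
   Context: $F_n$ is the free group on $n$ generators; the descending central series of a group $Q$ is $\Gamma^1(Q)=Q$, $\Gamma^{k+1}(Q)=[\Gamma^k(Q),Q]$, and $\Gamma^3_n:=\Gamma^3(F_n)$. Homomorphisms $F_n/\Gamma^3_n\to G$ are identified with the corresponding $n$-tuples in $G^n$. $\mathrm{Rep}(\Gamma,G)$ is the orbit space of $\mathrm{Hom}(\Gamma,G)$ under the conjugation action of $G$. For a partition $\mathbf{a}$ of the set $\{1,\dots,m\}$ into disjoint non-empty subsets (parts), $U(\mathbf{a})$ is the subgroup of $U(m)$ of matrices whose $(i,j)$-th entry is $0$ whenever $i$ and $j$ are in different parts of $\mathbf{a}$, and $Z_{\mathbf{a}}$ is the center of $U(\mathbf{a})$, consisting of the diagonal matrices $\mathrm{diag}(\lambda_1,\dots,\lambda_m)\in U(m)$ with $\lambda_i=\lambda_j$ whenever $i$ and $j$ are in the same part. The notation $\mathbf{a}\vdash m$ means that $\mathbf{a}$ ranges over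 all partitions of the set $\{1,\dots,m\}$ in which each part consists of consecutive numbers and the parts are ordered by size. For a topological group $G$ and a closed subgroup $K\subset G$ contained in the center of $G$, the space of $K$-almost commuting $n$-tuples is $B_n(G,K)=\{(x_1,\ldots,x_n)\in G^n\mid [x_i,x_j]\in K,\ 1\le i,j\le n\}$. *)

(* Defs.v *)
From HB Require Import structures.
From mathcomp Require Import all_boot all_order all_algebra.
From mathcomp Require Import perm boolp classical_sets reals complex.
Set Implicit Arguments.
Unset Strict Implicit.
Unset Printing Implicit Defensive.

Local Open Scope classical_set_scope.
Local Open Scope group_scope.
Local Open Scope quotient_scope.

Definition subgroup (G : groupType) (A : set G) :=
  A 1 /\ (forall x y, A x -> A y -> A (x / y)).

Definition normal_subgroup (G : groupType) (A : set G) :=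
  subgroup A /\ (forall x g, A x -> A (x ^ g)).

Definition gen (G : groupType) (A : set G) : set G := smallest (@subgroup G) A.

Lemma subgroup_gen (G : groupType) (A : set G) : subgroup (gen A).
Proof.
split=> [B [[]] // | x y Ax Ay B BA].
by case: (BA) => -[_ Bdiv] _; apply: Bdiv; [exact: Ax | exact: Ay].
Qed.

Lemma normal_gen (G : groupType) (A : set G) :
  (forall x g, A x -> A (x ^ g)) -> normal_subgroup (gen A).
Proof.
move=> AJ; split; first exact: subgroup_gen.
move=> x g; have [g1 gD] := subgroup_gen A.
apply: (@smallest_sub _ _ _ [set x | gen A (x ^ g)]).
  split=> /= [|y z Ay Az]; first by rewrite conj1g.
  by rewrite conjMg conjVg; exact: gD.
by move=> y Ay /=; apply: sub_gen_smallest; exact: AJ.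
Qed.

Definition comm_sets (G : groupType) (A B : set G) : set G :=
  [set z | exists x y, [/\ A x, B y & z = [~ x, y]]].

(* lcs Q k is Gamma^k(Q) for k >= 1; lcs Q 0 is a dummy value. *)
Definition lcs (Q : groupType) (k : nat) : set Q :=
  iter k.-1 (fun A => gen (comm_sets A setT)) setT.
Arguments lcs : clear implicits.

Lemma lcs1 (Q : groupType) : lcs Q 1 = setT.
Proof. by []. Qed.

Lemma lcsS (Q : groupType) k :
  0 < k -> lcs Q k.+1 = gen (comm_sets (lcs Q k) setT).
Proof. by case: k. Qed.

Lemma normal_lcs (Q : groupType) k : normal_subgroup (lcs Q k).
Proof.
rewrite /lcs; elim: k.-1 => [|{}k [_ kJ]] //=; apply: normal_gen.
by move=> _ g [x [y [Ax _ ->]]]; exists (x ^ g), (y ^ g); rewrite conjRg; split=> //; apply: kJ.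
Qed.

Section QuotientGroup.
Variables (G : groupType) (N : set G) (nN : normal_subgroup N).

Definition coset_rel of normal_subgroup N :=
  fun x y : G => `[< N (x^-1 * y) >].

Let N1 : N 1. Proof. by case: nN => -[]. Qed.
Let ND x y : N x -> N y -> N (x / y).
Proof. by case: nN => -[_ Ndiv] _; apply: Ndiv. Qed.
Let NV x : N x -> N x^-1. Proof. by move/(ND N1); rewrite mul1g. Qed.
Let NM x y : N x -> N y -> N (x * y).
Proof. by move=> Nx /NV Ny; rewrite -(invgK y); apply: ND. Qed.
Let NJ x g : N x -> N (x ^ g). 
Proof. by case: nN => _ NJ; apply: NJ. Qed.

Lemma coset_rel_refl : reflexive (coset_rel nN).
Proof. by move=> x; apply/asboolP; rewrite mulVg. Qed.

Lemma coset_rel_sym : symmetric (coset_rel nN).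
Proof.
by move=> x y; apply/asboolP/asboolP => /NV; rewrite invgM invgK.
Qed.

Lemma coset_rel_trans : transitive (coset_rel nN).
Proof.
move=> y x z /asboolP Nxy /asboolP Nyz; apply/asboolP.
by have := NM Nxy Nyz; rewrite mulgA mulgK.
Qed.

Canonical coset_equiv :=
  EquivRel (coset_rel nN) coset_rel_refl coset_rel_sym coset_rel_trans.

Definition quotient_group := {eq_quot coset_equiv}.
HB.instance Definition _ := Choice.on quotient_group.
HB.instance Definition _ := EqQuotient.on quotient_group.

Definition quot_mul : quotient_group -> quotient_group -> quotient_group :=
  lift_op2 quotient_group (fun x y : G => x * y).
Definition quot_inv : quotient_group -> quotient_group :=
  lift_op1 quotient_group (fun x : G => x^-1).

Lemma pi_quot_mul : {morph \pi_quotient_group : x y / x * y >-> quot_mul x y}.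
Proof.
move=> x y; unlock quot_mul; apply/eqmodP/asboolP.
have /eqmodP/asboolP Nx := esym (reprK (\pi_quotient_group x)).
have /eqmodP/asboolP Ny := esym (reprK (\pi_quotient_group y)).
set x' := repr _ in Nx *; set y' := repr _ in Ny *.
suff -> : (x * y)^-1 * (x' * y') = (x^-1 * x') ^ y * (y^-1 * y').
  by apply: NM => //; apply: NJ.
by rewrite invgM conjgE -!mulgA mulVKg.
Qed.

Lemma pi_quot_inv : {morph \pi_quotient_group : x / x^-1 >-> quot_inv x}.
Proof.
move=> x; unlock quot_inv; apply/eqmodP/asboolP.
have /eqmodP/asboolP Nx := esym (reprK (\pi_quotient_group x)).
set x' := repr _ in Nx *.
suff -> : x^-1^-1 * x'^-1 = ((x^-1 * x')^-1) ^ x^-1 by apply: NJ; apply: NV.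
by rewrite conjgE invgM !invgK mulgK.
Qed.

Let quot_mulA : associative quot_mul.
Proof.
elim/quotW=> x; elim/quotW=> y; elim/quotW=> z.
by rewrite -!pi_quot_mul mulgA.
Qed.

Let quot_mul1 : left_id (\pi_quotient_group 1) quot_mul.
Proof. by elim/quotW=> x; rewrite -pi_quot_mul mul1g. Qed.

Let quot_mulr1 : right_id (\pi_quotient_group 1) quot_mul.
Proof. by elim/quotW=> x; rewrite -pi_quot_mul mulg1. Qed.

Let quot_mulV : left_inverse (\pi_quotient_group 1) quot_inv quot_mul.
Proof. by elim/quotW=> x; rewrite -pi_quot_inv -pi_quot_mul mulVg. Qed.

Let quot_mulrV : right_inverse (\pi_quotient_group 1) quot_inv quot_mul.
Proof. by elim/quotW=> x; rewrite -pi_quot_inv -pi_quot_mul mulgV. Qed.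

HB.instance Definition _ := isGroup.Build quotient_group
  quot_mulA quot_mul1 quot_mulr1 quot_mulV quot_mulrV.

Lemma quot_piM (x y : G) :
  \pi_quotient_group (x * y) = \pi_quotient_group x * \pi_quotient_group y.
Proof. exact: pi_quot_mul. Qed.

End QuotientGroup.

(* A letter (i, false) stands for the i-th generator, (i, true) for its       *)
(* inverse; the free group is the set of words modulo the congruence          *)
(* generated by deleting two adjacent mutually inverse letters.               *)
Section FreeGroup.
Variable n : nat.

Definition letter := ('I_n * bool)%type.
Definition letter_inv (l : letter) : letter := (l.1, ~~ l.2).
Definition word_inv (w : seq letter) := rev (map letter_inv w).

Inductive word_eq : seq letter -> seq letter -> Prop :=
| word_eq_cancel u l v : word_eq (u ++ [:: l; letter_inv l] ++ v) (u ++ v)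
| word_eq_refl u : word_eq u u
| word_eq_sym u v : word_eq u v -> word_eq v u
| word_eq_trans v u w : word_eq u v -> word_eq v w -> word_eq u w.

Definition word_rel (u v : seq letter) := `[< word_eq u v >].

Lemma word_rel_refl : reflexive word_rel.
Proof. by move=> u; apply/asboolP; apply: word_eq_refl. Qed.

Lemma word_rel_sym : symmetric word_rel.
Proof. by move=> u v; apply/asboolP/asboolP; apply: word_eq_sym. Qed.

Lemma word_rel_trans : transitive word_rel.
Proof.
move=> v u w /asboolP uv /asboolP vw; apply/asboolP.
exact: word_eq_trans uv vw.
Qed.

Canonical word_equiv :=
  EquivRel word_rel word_rel_refl word_rel_sym word_rel_trans.

Definition free_group := {eq_quot word_equiv}.
HB.instance Definition _ := Choice.on free_group.
HB.instance Definition _ := EqQuotient.on free_group.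

Lemma letter_invK : involutive letter_inv.
Proof. by case=> i b; rewrite /letter_inv /= negbK. Qed.

Lemma word_invK : involutive word_inv.
Proof.
move=> w; rewrite /word_inv map_rev revK -map_comp map_id_in //.
by move=> l _; apply: letter_invK.
Qed.

Lemma word_eq_catl u v w : word_eq v w -> word_eq (u ++ v) (u ++ w).
Proof.
elim=> {v w} [v l w|v|v w _|v w z _ vw _ wz].
- by rewrite catA [u ++ (v ++ w)]catA; apply: word_eq_cancel.
- exact: word_eq_refl.
- exact: word_eq_sym.
- exact: word_eq_trans vw wz.
Qed.

Lemma word_eq_catr u v w : word_eq v w -> word_eq (v ++ u) (w ++ u).
Proof.
elim=> {v w} [v l w|v|v w _|v w z _ vw _ wz].
- by rewrite -!catA; apply: word_eq_cancel.
- exact: word_eq_refl.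
- exact: word_eq_sym.
- exact: word_eq_trans vw wz.
Qed.

Lemma word_eq_inv v w : word_eq v w -> word_eq (word_inv v) (word_inv w).
Proof.
elim=> {v w} [v l w|v|v w _|v w z _ vw _ wz].
- rewrite /word_inv !map_cat !rev_cat -catA.
  have -> : rev (map letter_inv [:: l; letter_inv l])
    = [:: l; letter_inv l] by rewrite /= letter_invK.
  exact: word_eq_cancel.
- exact: word_eq_refl.
- exact: word_eq_sym.
- exact: word_eq_trans vw wz.
Qed.

Lemma word_eq_catV w : word_eq (w ++ word_inv w) [::].
Proof.
elim: w => [|l w IH]; first exact: word_eq_refl.
rewrite /word_inv /= rev_cons -/(word_inv w) -cats1 catA.
apply: (@word_eq_trans ([:: l] ++ [:: letter_inv l])); last first.
  exact: (word_eq_cancel [::] l [::]).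
exact: (word_eq_catl [:: l] (word_eq_catr _ IH)).
Qed.

Definition free_mul : free_group -> free_group -> free_group :=
  lift_op2 free_group cat.
Definition free_inv : free_group -> free_group :=
  lift_op1 free_group word_inv.

Lemma pi_free_mul : {morph \pi_free_group : u v / u ++ v >-> free_mul u v}.
Proof.
move=> u v; unlock free_mul; apply/eqmodP/asboolP.
have /eqmodP/asboolP eu := esym (reprK (\pi_free_group u)).
have /eqmodP/asboolP ev := esym (reprK (\pi_free_group v)).
exact: word_eq_trans (word_eq_catr v eu) (word_eq_catl _ ev).
Qed.

Lemma pi_free_inv : {morph \pi_free_group : u / word_inv u >-> free_inv u}.
Proof.
move=> u; unlock free_inv; apply/eqmodP/asboolP.
have /eqmodP/asboolP eu := esym (reprK (\pi_free_group u)).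
exact: word_eq_inv.
Qed.

Let free_mulA : associative free_mul.
Proof.
elim/quotW=> x; elim/quotW=> y; elim/quotW=> z.
by rewrite -!pi_free_mul catA.
Qed.

Let free_mul1 : left_id (\pi_free_group [::]) free_mul.
Proof. by elim/quotW=> x; rewrite -pi_free_mul. Qed.

Let free_mulr1 : right_id (\pi_free_group [::]) free_mul.
Proof. by elim/quotW=> x; rewrite -pi_free_mul cats0. Qed.

Let free_mulrV : right_inverse (\pi_free_group [::]) free_inv free_mul.
Proof.
elim/quotW=> x; rewrite -pi_free_inv -pi_free_mul.
by apply/eqmodP/asboolP; apply: word_eq_catV.
Qed.

Let free_mulV : left_inverse (\pi_free_group [::]) free_inv free_mul.
Proof.
elim/quotW=> x; rewrite -{2}(word_invK x).
by rewrite -pi_free_inv -pi_free_mul; apply/eqmodP/asboolP; apply: word_eq_catV.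
Qed.

HB.instance Definition _ := isGroup.Build free_group
  free_mulA free_mul1 free_mulr1 free_mulV free_mulrV.

Lemma free_piM (u v : seq letter) :
  \pi_free_group (u ++ v) = \pi_free_group u * \pi_free_group v.
Proof. exact: pi_free_mul. Qed.

Definition free_gen (i : 'I_n) : free_group := \pi_free_group [:: (i, false)].

Section Extension.
Variables (G : groupType) (x : 'I_n -> G).

Definition letter_val (l : letter) : G := if l.2 then (x l.1)^-1 else x l.1.
Definition word_val (w : seq letter) : G := \prod_(l <- w) letter_val l.
Definition free_ext (q : free_group) : G := word_val (repr q).

Lemma word_val_cat u v : word_val (u ++ v) = word_val u * word_val v.
Proof. by rewrite /word_val big_cat. Qed.

Lemma word_val_eq u v : word_eq u v -> word_val u = word_val v.
Proof.
elim=> {u v} [u l v|u|u v _|u v w _ -> _ ->] //.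
rewrite !word_val_cat /word_val !big_cons big_nil mulg1.
suff -> : letter_val l * letter_val (letter_inv l) = 1 by rewrite mul1g.
by case: l => i [] /=; rewrite /letter_val /= ?mulVg ?mulgV.
Qed.

Lemma free_ext_pi w : free_ext (\pi_free_group w) = word_val w.
Proof.
have /eqmodP/asboolP e := reprK (\pi_free_group w).
exact: word_val_eq.
Qed.

Let free_extM : {morph free_ext : p q / p * q}.
Proof.
elim/quotW=> u; elim/quotW=> v.
by rewrite -free_piM !free_ext_pi word_val_cat.
Qed.

HB.instance Definition _ := isMultiplicative.Build free_group G free_ext
  free_extM.

Lemma free_ext_gen i : free_ext (free_gen i) = x i.
Proof. by rewrite free_ext_pi /word_val big_seq1. Qed.

End Extension.

End FreeGroup.

Definition free_nil (n k : nat) : groupType :=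
  quotient_group (normal_lcs (free_group n) k).

Definition free_nil_gen (n k : nat) (i : 'I_n) : free_nil n k :=
  \pi_(quotient_group (normal_lcs (free_group n) k)) (free_gen i).

Section Representations.
Variables (Gamma G : groupType).

(* Rep is the orbit space of the conjugation action on homomorphisms, its     *)
(* points being the orbits themselves; rep_proj is the quotient map.          *)
Definition ghom := {multiplicative Gamma -> G}.

Definition rep_proj (f : ghom) : set ghom :=
  [set h : ghom | exists g : G, forall x, h x = f x ^ g].

Definition Rep : set (set ghom) := [set rep_proj f | f in [set: ghom]].

End Representations.
Arguments Rep : clear implicits.

(* The identification of Hom(F_n / Gamma^k, G) with a subset of G^n.           *)
Definition hom_tuple (n k : nat) (G : groupType) (f : ghom (free_nil n k) G) :
    {ffun 'I_n -> G} :=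
  [ffun i => f (free_nil_gen k i)].

Lemma hom_tuple_inj (n k : nat) (G : groupType) (f g : ghom (free_nil n k) G) :
  hom_tuple f = hom_tuple g -> f =1 g.
Proof.
move=> /ffunP fg; elim/quotW; elim/quotW.
pose p w : free_nil n k :=
  \pi_(quotient_group (normal_lcs (free_group n) k)) (\pi_(free_group n) w).
have hom1 (h : ghom (free_nil n k) G) : h 1 = 1.
  by apply: (mulIg (h 1)); rewrite -gmulfM !mul1g.
have pM u v : p (u ++ v) = p u * p v by rewrite /p free_piM quot_piM.
have p1 : p [::] = 1 by [].
suff fgp w : f (p w) = g (p w) by move=> w; apply: fgp.
elim: w => [|[i b] w IH]; first by rewrite p1 !hom1.
rewrite -cat1s pM !gmulfM IH; congr (_ * _).
have fgi : f (p [:: (i, false)]) = g (p [:: (i, false)]).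
  by have := fg i; rewrite !ffunE.
case: b => //; apply: (mulIg (f (p [:: (i, false)]))).
rewrite {2}fgi -!gmulfM -pM; suff -> : p ([:: (i, true)] ++ [:: (i, false)]) = 1.
  by rewrite !hom1.
rewrite -p1; congr (\pi_(quotient_group _) _); apply/eqmodP/asboolP.
exact: (word_eq_cancel [::] (i, true) [::]).
Qed.

(* B_n(G, K) for subgroups G and K of an ambient group gT, seen inside gT^n.   *)
Definition almost_commuting (gT : groupType) (n : nat) (G K : set gT) :
    set {ffun 'I_n -> gT} :=
  [set x | (forall i, G (x i)) /\ (forall i j, K [~ x i, x j])].

Section UnitaryGroup.
Variables (C : numClosedFieldType) (m : nat).

Record unitary := Unitary { umx :> 'M[C]_m; _ : umx \is unitarymx }.
HB.instance Definition _ := [isSub for umx].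
HB.instance Definition _ := [Choice of unitary by <:].

Lemma umxP (A : unitary) : umx A \is unitarymx. Proof. exact: valP. Qed.

Fact unitary1_subproof : (1%:M%R : 'M[C]_m) \is unitarymx.
Proof. by apply/unitarymxP; rewrite trmx1 map_mx1 mulmx1. Qed.
Definition unitary_one := Unitary unitary1_subproof.
Definition unitary_mul (A B : unitary) :=
  Unitary (mul_unitarymx (umxP A) (umxP B)).
Fact unitaryV_subproof (A : unitary) : invmx A \is unitarymx.
Proof. by rewrite invmx_unitary ?umxP // trmxC_unitary umxP. Qed.
Definition unitary_inv (A : unitary) := Unitary (unitaryV_subproof A).

Let unitary_mulA : associative unitary_mul.
Proof. by move=> A B D; apply: val_inj; apply: mulmxA. Qed.
Let unitary_mul1 : left_id unitary_one unitary_mul.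
Proof. by move=> A; apply: val_inj; apply: mul1mx. Qed.
Let unitary_mulr1 : right_id unitary_one unitary_mul.
Proof. by move=> A; apply: val_inj; apply: mulmx1. Qed.
Let unitary_mulV : left_inverse unitary_one unitary_inv unitary_mul.
Proof. by move=> A; apply/val_inj/mulVmx/unitarymx_unit/umxP. Qed.
Let unitary_mulrV : right_inverse unitary_one unitary_inv unitary_mul.
Proof. by move=> A; apply/val_inj/mulmxV/unitarymx_unit/umxP. Qed.

HB.instance Definition _ := isGroup.Build unitary
  unitary_mulA unitary_mul1 unitary_mulr1 unitary_mulV unitary_mulrV.

Lemma umxM (A B : unitary) : umx (A * B) = (umx A *m umx B)%R.
Proof. by []. Qed.

Lemma umxV (A : unitary) : umx A^-1 = invmx (umx A).
Proof. by []. Qed.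

Definition block_unitary (a : {set {set 'I_m}}) : set unitary :=
  [set A | forall i j, j \notin finset.pblock a i -> umx A i j = 0%R].

End UnitaryGroup.

Definition center (gT : groupType) (G : set gT) : set gT :=
  [set z | G z /\ (forall x, G x -> commute z x)].

(* Parts are intervals of consecutive indices; "ordered by size" is taken in  *)
(* the usual convention for integer partitions: sizes weakly decrease from    *)
(* left to right.                                                             *)
Definition ordered_partition (m : nat) (a : {set {set 'I_m}}) :=
  [/\ finset.partition a [set: 'I_m]%SET,
      forall A, A \in a -> forall i j k : 'I_m,
        i \in A -> k \in A -> i <= j -> j <= k -> j \in A
    & forall A B, A \in a -> B \in a -> forall i j : 'I_m,
        i \in A -> j \in B -> i < j -> #|B| <= #|A|].

Section Center.
Import GRing.Theory Num.Theory.
Local Open Scope ring_scope.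

Lemma center_block_unitaryP (C : numClosedFieldType) (m : nat)
    (a : {set {set 'I_m}}) (z : unitary C m) :
  finset.partition a [set: 'I_m]%SET ->
  center (block_unitary a) z <->
  exists2 d : 'rV[C]_m, umx z = diag_mx d &
    forall i j, j \in finset.pblock a i -> d 0 i = d 0 j.
Proof.
case/and3P=> /eqP cov_a triv_a _.
have mem_pb i : i \in finset.pblock a i by rewrite mem_pblock cov_a inE.
have pb_sym i j : j \in finset.pblock a i -> i \in finset.pblock a j.
  by move=> /(same_pblock triv_a) ->.
split=> [[_ zC] | [d zE dE]].
  have zCmx x : block_unitary a x -> umx z *m umx x = umx x *m umx z.
    by move=> /zC zx; rewrite -!umxM zx.
  have z_off k i : k != i -> umx z k i = 0.
    move=> ki; pose e := \row_l (-1 : C) ^+ (l == i).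
    have eU : diag_mx e \is unitarymx.
      apply/unitarymxP; rewrite tr_diag_mx map_diag_mx mulmx_diag.
      apply/matrixP=> r c; rewrite !mxE; congr (_ *+ _).
      by rewrite rmorphXn rmorphN1 -exprMn mulrNN mulr1 expr1n.
    have eB : block_unitary a (Unitary eU).
      move=> r c /=; rewrite mxE; case: eqVneq => [->|] //.
      by rewrite mem_pb.
    have /matrixP/(_ k i) := zCmx _ eB.
    rewrite /= mul_mx_diag mul_diag_mx !mxE eqxx (negbTE ki) mulrN1 mul1r.
    by move/eqP; rewrite eqNr => /eqP.
  exists (\row_k umx z k k).
    apply/matrixP=> r c; rewrite !mxE.
    by case: eqVneq => [->|/z_off]; rewrite ?mulr1n ?mulr0n.
  move=> i j ij; rewrite !mxE.
  have sU : perm_mx (tperm i j) \is @unitarymx C m m.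
    apply/unitarymxP; rewrite tr_perm_mx map_perm_mx -perm_mxM mulgV.
    exact: perm_mx1.
  have sB : block_unitary a (Unitary sU).
    move=> r c rc; rewrite !mxE; case: eqP => //= src; case/negP: rc.
    rewrite -src; case: tpermP => [->|->|_ _] //; exact: pb_sym.
  have /matrixP/(_ i j) := zCmx _ sB.
  rewrite /= -[perm_mx _]/(tperm_mx i j) -xcolE -xrowE !mxE tpermL tpermR.
  by [].
split=> [i j ij | x xB].
  rewrite zE mxE; case: eqVneq => [ij'|]; last by rewrite mulr0n.
  by move: ij; rewrite ij' mem_pb.
apply: val_inj => /=; rewrite zE mul_diag_mx mul_mx_diag.
apply/matrixP=> i j; rewrite !mxE mulrC.
have [ji|/xB ->] := boolP (j \in finset.pblock a i); last by rewrite !mul0r.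
by rewrite (dE _ _ ji).
Qed.
End Center.

(* Main.v *)
(* An n-tuple is a homomorphism from F_n / Gamma^3 exactly when all commutators
   of its entries are central in the subgroup generated by the entries. Those
   commutators then commute pairwise, so a single unitary conjugation makes all
   of them diagonal. The entries of the conjugated tuple commute with these
   diagonal matrices, hence preserve their common eigenspaces, and on each common
   eigenspace the commutators are scalar. Conjugating by a permutation matrix
   turns the eigenspaces into an ordered partition of the coordinates. *)
From HB Require Import structures.
Require Import Defs.
From mathcomp Require Import all_boot all_order all_algebra.
From mathcomp Require Import perm boolp classical_sets reals complex.
Set Implicit Arguments.
Unset Strict Implicit.
Unset Printing Implicit Defensive.
Local Open Scope classical_set_scope.
Local Open Scope group_scope.
Local Open Scope quotient_scope.

(** * Commutator identities, subgroups and centralizers *)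

Section Subgroups.
Variable G : groupType.
Implicit Types A : set G.

Lemma commMg_conj (x y z : G) : [~ x * y, z] = [~ x, z] ^ y * [~ y, z].
Proof. by rewrite /commg !conjgE !invgM !mulgA !mulgK. Qed.

Lemma conjg_commute (x y : G) : commute x y -> x ^ y = x.
Proof. by rewrite conjgE => ->; rewrite mulKg. Qed.

Lemma subgroupM A x y : subgroup A -> A x -> A y -> A (x * y).
Proof.
move=> [A1 AD] Ax Ay; rewrite -(invgK y); apply: (AD) => //.
by rewrite -(mul1g y^-1); apply: AD.
Qed.

Lemma subgroupV A x : subgroup A -> A x -> A x^-1.
Proof. by move=> [A1 AD] Ax; rewrite -(mul1g x^-1); apply: AD. Qed.

Lemma subgroup_centralizer A :
  subgroup [set c : G | forall y, A y -> commute c y].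
Proof.
split=> [y _|c d cA dA y Ay] /=; first exact/commute_sym/commute1.
apply/commute_sym/commuteM; first exact/commute_sym/cA.
exact/commuteV/commute_sym/dA.
Qed.

(** On such [y] the map [y] to [[~ y, z]] is multiplicative: the conjugation in [commMg_conj] is by
    an element of [A], hence trivial. This is what extends centrality of commutators from generators
    to words. *)
Lemma subgroup_commg_centralizer A z : subgroup A ->
  subgroup [set y | A y /\ forall a, A a -> commute [~ y, z] a].
Proof.
move=> sA; split=> [|y t [Ay yC] [At tC]].
  by split=> [|a _]; [case: sA | rewrite comm1g; exact/commute_sym/commute1].
have Atv := subgroupV sA At.
split=> [|a Aa]; first exact: subgroupM.
have tvC : [~ t^-1, z] = [~ t, z]^-1.
  have : [~ t, z] ^ t^-1 * [~ t^-1, z] = 1.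
    by rewrite -commMg_conj mulgV comm1g.
  by rewrite (conjg_commute (tC _ Atv)) => /(canRL (mulKg _)); rewrite mulg1.
rewrite commMg_conj tvC (conjg_commute (yC _ Atv)).
apply/commute_sym/commuteM; first exact/commute_sym/yC.
exact/commuteV/commute_sym/tC.
Qed.

End Subgroups.

(** * Homomorphisms and factorization through quotients *)

Section MultiplicativeMaps.
Variables (G H : groupType) (f : {multiplicative G -> H}).

Lemma multiplicative1 : f 1 = 1.
Proof. by apply: (mulIg (f 1)); rewrite -gmulfM !mul1g. Qed.

Lemma multiplicativeV x : f x^-1 = (f x)^-1.
Proof. by apply: (mulIg (f x)); rewrite -gmulfM !mulVg multiplicative1. Qed.

Lemma multiplicativeR x y : f [~ x, y] = [~ f x, f y].
Proof. by rewrite !gmulfM !multiplicativeV. Qed.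

Lemma subgroup_range : subgroup (range f).
Proof.
split=> [|_ _ [p _ <-] [q _ <-]].
  by exists 1 => //; exact: multiplicative1.
by exists (p / q) => //; rewrite gmulfM multiplicativeV.
Qed.

Lemma subgroup_preimage A : subgroup A -> subgroup (f @^-1` A).
Proof.
move=> [A1 AD]; split=> [|p q Ap Aq] /=; first by rewrite multiplicative1.
by rewrite gmulfM multiplicativeV; apply: AD.
Qed.

End MultiplicativeMaps.

Lemma free_ext_subgroup (n : nat) (G : groupType) (x : 'I_n -> G) (A : set G) q :
  subgroup A -> (forall i, A (x i)) -> A (free_ext x q).
Proof.
move=> sA Ax; rewrite /free_ext; elim: (repr q) => [|[i b] w IH].
  by rewrite /word_val big_nil; case: sA.
rewrite /word_val big_cons; apply: subgroupM => //.
by case: b; rewrite /letter_val //=; apply: subgroupV.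
Qed.

Section QuotientMap.
Variables (G : groupType) (N : set G) (nN : normal_subgroup N).

Definition quot_map (x : G) : quotient_group nN := \pi x.

HB.instance Definition _ :=
  isMultiplicative.Build G (quotient_group nN) quot_map (quot_piM nN).

Lemma quot_map1 x : N x -> quot_map x = 1.
Proof.
move=> Nx; apply/esym/eqmodP/asboolP.
by rewrite invg1 mul1g.
Qed.

End QuotientMap.

Section QuotientHom.
Variables (G H : groupType) (N : set G) (nN : normal_subgroup N).
Variable f : {multiplicative G -> H}.

(** The kernel condition is an argument so that the multiplicative structure below can be attached
    to the function. *)
Definition quot_ext of (forall x, N x -> f x = 1) : quotient_group nN -> H :=
  fun q => f (repr q).

Hypothesis fN : forall x, N x -> f x = 1.

Lemma quot_ext_pi x : quot_ext fN (\pi x) = f x.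
Proof.
have /eqmodP/asboolP/fN := reprK (\pi_(quotient_group nN) x).
rewrite /quot_ext; set y := repr _ => fyx.
by rewrite -[in RHS](mulVKg y x) gmulfM fyx mulg1.
Qed.

Fact quot_extM : {morph quot_ext fN : p q / p * q}.
Proof.
elim/quotW=> p; elim/quotW=> q.
by rewrite -quot_piM !quot_ext_pi gmulfM.
Qed.

HB.instance Definition _ :=
  isMultiplicative.Build (quotient_group nN) H (quot_ext fN) quot_extM.
End QuotientHom.

(** * Homomorphisms out of the free two-step nilpotent group *)

Section TwoStepNilpotent.
Variables (n : nat) (G : groupType) (x : 'I_n -> G).
Hypothesis xC : forall i j k, commute [~ x i, x j] (x k).

Lemma free_ext_commg_central p q r :
  commute [~ free_ext x p, free_ext x q] (free_ext x r).
Proof.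
have sA := subgroup_range (free_ext x).
pose C (c : G) := forall a, range (free_ext x) a -> commute c a.
have sC : subgroup C by exact: subgroup_centralizer.
have Ax i : range (free_ext x) (x i).
  by exists (free_gen i) => //; rewrite free_ext_gen.
have Cx i j : C [~ x i, x j].
  move=> _ [w _ <-]; apply/commute_sym.
  apply: (free_ext_subgroup w (subgroup_centralizer [set [~ x i, x j]])) => //.
  by move=> k _ ->; exact/commute_sym.
(* Only the first slot of the commutator passes from generators to words. Using this twice, with
   [[~ a, b]^-1 = [~ b, a]] in between, covers both slots. *)
have CL (z : G) w : (forall i, C [~ x i, z]) -> C [~ free_ext x w, z].
  move=> Cz; have sz := subgroup_commg_centralizer z sA.
  by have [] := free_ext_subgroup w sz (fun i => conj (Ax i) (Cz i)).
apply: (CL); last by exists r.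
move=> i; rewrite -invgR; apply: (subgroupV sC); exact: CL.
Qed.

(** The second term of the central series maps into the centralizer of the image, so one more
    commutator is trivial. *)
Lemma free_ext_lcs3 w : lcs (free_group n) 3 w -> free_ext x w = 1.
Proof.
pose C := [set c : G | forall a, range (free_ext x) a -> commute c a].
have sC : subgroup C by exact: subgroup_centralizer.
have CL : lcs (free_group n) 2 `<=` free_ext x @^-1` C.
  apply: smallest_sub; first exact: subgroup_preimage.
  move=> _ [p [q [_ _ ->]]] _ [r _ <-]; rewrite multiplicativeR.
  exact: free_ext_commg_central.
suff : lcs (free_group n) 3 `<=` free_ext x @^-1` [set 1] by apply.
apply: smallest_sub.
  by apply: subgroup_preimage; split=> // _ _ -> ->; rewrite divg1.
move=> _ [p [q [/CL pC _ ->]]] /=; rewrite multiplicativeR.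
by apply/eqP/commgP/pC; exists q.
Qed.

Lemma free_nil3_hom_exists :
  exists f : ghom (free_nil n 3) G, hom_tuple f = [ffun i => x i].
Proof.
exists (quot_ext free_ext_lcs3 : free_nil n 3 -> G).
by apply/ffunP=> i; rewrite !ffunE [LHS]quot_ext_pi; exact: free_ext_gen.
Qed.

End TwoStepNilpotent.

Lemma free_nil3_hom_commute (n : nat) (G : groupType)
    (f : ghom (free_nil n 3) G) (i j k : 'I_n) :
  commute [~ hom_tuple f i, hom_tuple f j] (hom_tuple f k).
Proof.
rewrite /hom_tuple !ffunE -multiplicativeR.
pose q : {multiplicative free_group n -> free_nil n 3} :=
  quot_map (normal_lcs (free_group n) 3).
apply/gmulf_commute/commgP/eqP.
(* The triple commutator of free generators lies in the third term of the series, so the projection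
   kills it. *)
transitivity (q [~ free_gen i, free_gen j, free_gen k]).
  by rewrite !multiplicativeR.
apply: quot_map1; apply: sub_gen_smallest; eexists _, _; split=> //.
by apply: sub_gen_smallest; eexists _, _.
Qed.

(** * Conjugate homomorphisms and their orbits *)

Section ConjugateHom.
Variables (Gamma G : groupType) (f : ghom Gamma G) (g : G).

Definition conj_hom : Gamma -> G := fun p => f p ^ g.

Fact conj_homM : {morph conj_hom : p q / p * q}.
Proof. by move=> p q; rewrite /conj_hom gmulfM conjMg. Qed.

HB.instance Definition _ :=
  isMultiplicative.Build Gamma G conj_hom conj_homM.

Lemma rep_proj_conj : rep_proj (conj_hom : ghom Gamma G) = rep_proj f.
Proof.
apply/seteqP; split=> h [u hE].
  by exists (g * u) => p; rewrite hE conjgM.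
by exists (g^-1 * u) => p; rewrite hE /= /conj_hom -conjgM mulgA mulgV mul1g.
Qed.

End ConjugateHom.

(** * Ordered partitions from the fibres of a function *)

Lemma preim_partition_pblockE (I : finType) (T : eqType) (f : I -> T) i j :
  (j \in finset.pblock (preim_partition f [set: I]%SET) i) = (f i == f j).
Proof.
have eqR : {in [set: I]%SET & &, equivalence_rel (fun i j => f i == f j)}.
  by split=> // /eqP->.
by rewrite (pblock_equivalence_partition eqR) ?inE.
Qed.

Section OrderedPartition.
Variables (m : nat) (T : eqType) (f : 'I_m -> T).

Lemma sorting_perm (key : 'I_m -> nat) :
  exists s : 'S_m, forall i j : 'I_m, i <= j -> key (s i) <= key (s j).
Proof.
pose r i j := key i <= key j.
have rT : total r by move=> i j; exact: leq_total.
have rtr : transitive r by move=> j i k; exact: leq_trans.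
(* [s i] is the entry at position [i] of the indices sorted by [key]. *)
have /tuple_permP [s sE] : perm_eq (sort r (enum 'I_m)) (ord_tuple m).
  by rewrite perm_sort val_ord_tuple.
exists s => i j ij.
have := sorted_leq_nth rtr (fun i => leqnn (key i)) i (sort_sorted rT (enum 'I_m)).
move=> /(_ i j); rewrite !inE size_sort size_enum_ord !ltn_ord => /(_ isT isT ij).
rewrite sE /r.
have nthE (k : 'I_m) : nth i [tuple tnth (ord_tuple m) (s i) | i < m] k = s k.
  by rewrite -tnth_nth tnth_mktuple tnth_ord_tuple.
by rewrite !nthE.
Qed.

(** Sorting by a key that separates exactly the fibres of [f] makes every fibre an interval; letting
    large fibres have small keys orders the blocks by size. *)
Lemma ordered_preim_partition :
  exists s : 'S_m, ordered_partition (preim_partition (f \o s) [set: 'I_m]%SET).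
Proof.
pose cls i : {set 'I_m} := [set j | f j == f i]%SET.
pose N := #|{: {set 'I_m}}|.
(* Decreasing class size first, ties broken by an arbitrary rank of the class. *)
pose key i := ((m - #|cls i|) * N + enum_rank (cls i))%N.
have N_gt0 : 0 < N by apply/card_gt0P; exists (finset.set0 : {set _}).
(* A rank is less than [N], so division by [N] recovers both components of the key. *)
have key_div i : key i %/ N = (m - #|cls i|)%N.
  by rewrite /key divnMDl // divn_small ?addn0.
have key_mod i : key i %% N = enum_rank (cls i).
  by rewrite /key modnMDl modn_small.
have key_eq i j : key i = key j -> f i = f j.
  move=> ij.
  have /ord_inj/enum_rank_inj cij : enum_rank (cls i) = enum_rank (cls j) :> nat.
    by rewrite -!key_mod ij.
  have : i \in cls i by rewrite inE.
  by rewrite cij inE => /eqP.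
have f_key i j : f i = f j -> key i = key j by move=> ij; rewrite /key /cls ij.
have [s sP] := sorting_perm key; exists s.
have pP := preim_partitionP (f \o s) [set: 'I_m]%SET.
have /and3P[_ triv _] := pP.
have blockE A i : A \in preim_partition (f \o s) [set: 'I_m]%SET -> i \in A ->
    A = [set j | f (s j) == f (s i)]%SET.
  move=> PA Ai; rewrite -(def_pblock triv PA Ai); apply/setP=> j.
  by rewrite preim_partition_pblockE inE eq_sym.
have card_block i : #|[set j | f (s j) == f (s i)]%SET| = #|cls (s i)|.
  rewrite -(card_imset _ (@perm_inj _ s)); apply: eq_card => k.
  apply/imsetP/idP => [[j]|]; rewrite !inE; first by move=> ? ->.
  by move=> kE; exists (s^-1%g k); rewrite ?inE permKV.
split=> // [A PA i j k Ai Ak ij jk|A B PA PB i j Ai Bj ij].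
  (* The key at [s j] is squeezed between the equal keys at [s i] and [s k]. *)
  move: Ak; rewrite (blockE A i PA Ai) !inE => /eqP/f_key ki.
  apply/eqP/key_eq/eqP; rewrite eqn_leq -{1}ki !sP //.
rewrite (blockE A i PA Ai) (blockE B j PB Bj) !card_block.
have /(leq_div2r N) := sP _ _ (ltnW ij); rewrite !key_div.
(* Truncated subtraction from [m] reverses the order faithfully because a class has at most [m]
   elements. *)
by rewrite leq_sub2lE // -[X in _ <= X]card_ord max_card.
Qed.

End OrderedPartition.

(** * Simultaneous diagonalization and permutation of coordinates *)

Section UnitaryDiagonalization.
Import GRing.Theory Num.Theory.
Local Open Scope ring_scope.
Local Open Scope sesquilinear_scope.
Variables (C : numClosedFieldType) (m : nat).
Implicit Types A B g : unitary C m.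

Lemma umx_adj A : umx A^-1%g = (umx A)^t*.
Proof. by rewrite umxV invmx_unitary ?umxP. Qed.

Lemma commute_umx A B : commute A B -> comm_mx (umx A) (umx B).
Proof. by move=> AB; rewrite /comm_mx -!umxM AB. Qed.

Lemma unitary_codiagonalization (I : finType) (A : I -> unitary C m) :
  (forall i j, commute (A i) (A j)) ->
  exists g, forall i, is_diag_mx (umx (A i ^ g)%g).
Proof.
move=> AC.
(* Inverses are triangularized along with the matrices: a lower triangular
   unitary matrix whose inverse, i.e. its adjoint, is also lower triangular is
   diagonal. *)
pose U (p : bool * I) : unitary C m := if p.1 then (A p.2)^-1%g else A p.2.
have UC p q : commute (U p) (U q).
  have AU i : commute (A i) (U q).
    by rewrite /U; case: q => -[] j; [exact/commuteV/AC | exact: AC].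
  by case: p => -[] i; [exact/commute_sym/commuteV/commute_sym/AU | exact: AU].
have [|P PU /allP PT] := @cotrigonalization C m [seq umx (U p) | p : bool * I].
  by move=> _ _ /mapP[p _ ->] /mapP[q _ ->]; exact: commute_umx.
(* The inverse appears because [x ^ g] is [g^-1 * x * g], while similarity by [P] is
   [P *m A *m invmx P]. *)
exists (Unitary PU)^-1%g => i.
have trig p : is_trig_mx (umx (U p ^ (Unitary PU)^-1)%g).
  have -> : umx (U p ^ (Unitary PU)^-1)%g = P *m umx (U p) *m invmx P.
    by rewrite conjgE invgK mulgA !umxM umxV.
  have := PT _ (map_f (fun p => umx (U p)) (mem_enum predT p)).
  by rewrite /= /similar_to conjumx ?unitarymx_unit.
have iT : is_trig_mx (umx (A i ^ (Unitary PU)^-1)%g) := trig (false, i).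
have iVT : is_trig_mx (umx ((A i ^ (Unitary PU)^-1)^-1)%g).
  by rewrite -conjVg; exact: (trig (true, i)).
apply/is_diag_mxP => k l; rewrite neq_ltn => /orP[kl|lk].
  exact: (is_trig_mxP _).
have /is_trig_mxP/(_ _ _ lk) := iVT.
by rewrite umx_adj !mxE => /eqP; rewrite conjC_eq0 => /eqP.
Qed.

Lemma unitary_perm_conj (s : 'S_m) :
  exists g, forall A k l, umx (A ^ g)%g k l = umx A (s k) (s l).
Proof.
have sU : perm_mx s^-1%g \is @unitarymx C m m.
  apply/unitarymxP; rewrite tr_perm_mx map_perm_mx -perm_mxM mulgV.
  exact: perm_mx1.
exists (Unitary sU) => A k l.
rewrite conjgE 2!umxM umx_adj /= tr_perm_mx map_perm_mx invgK.
by rewrite -row_permE -col_permE !mxE.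
Qed.

End UnitaryDiagonalization.

(** * Block form of the tuple and passage to orbits *)

Lemma commute_conjg (G : groupType) (x y g : G) :
  commute x y -> commute (x ^ g) (y ^ g).
Proof. by rewrite /commute -!conjMg => ->. Qed.

Lemma commute_commg (G : groupType) (c x y : G) :
  commute c x -> commute c y -> commute c [~ x, y].
Proof.
by move=> cx cy; rewrite /commg conjgE; do ?apply: commuteM => //; apply: commuteV.
Qed.

(** The [(k, l)] entry of [DA = AD] reads [D k k * A k l = A k l * D l l]. *)
Lemma comm_diag_mx_entry (F : fieldType) (m : nat) (A D : 'M[F]_m) (k l : 'I_m) :
  comm_mx D A -> is_diag_mx D -> D k k != D l l -> A k l = 0%R.
Proof.
move=> DA /is_diag_mxP Dd Dkl; have /matrixP/(_ k l) := DA; rewrite !mxE.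
rewrite (bigD1 k) //= big1 => [|j jk]; last by rewrite Dd ?GRing.mul0r // eq_sym.
rewrite (bigD1 l) //= big1 => [|j jl]; last by rewrite Dd ?GRing.mulr0.
rewrite !GRing.addr0 GRing.mulrC => /eqP; rewrite -GRing.subr_eq0 -GRing.mulrBr.
by rewrite GRing.mulf_eq0 GRing.subr_eq0 (negbTE Dkl) orbF => /eqP.
Qed.

Lemma almost_commuting_conj (C : numClosedFieldType) (m n : nat)
    (x : {ffun 'I_n -> unitary C m}) :
  (forall i j k, commute [~ x i, x j] (x k)) ->
  exists g a, ordered_partition a /\
    almost_commuting (block_unitary a) (center (block_unitary a))
      [ffun i => x i ^ g].
Proof.
move=> xC.
pose c (p : 'I_n * 'I_n) := [~ x p.1, x p.2].
have [g cD] : exists g, forall p, is_diag_mx (umx (c p ^ g)).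
  by apply: unitary_codiagonalization => p q; apply: commute_commg; exact: xC.
(* [d k] lists the eigenvalues of all commutators on the [k]-th basis vector, so its fibres index
   the common eigenspaces. *)
pose d k := [ffun p => umx (c p ^ g) k k].
have [s aP] := ordered_preim_partition d.
have [h hE] := unitary_perm_conj C s.
set a := preim_partition _ _ in aP; exists (g * h), a; split=> //.
have cgC p i : comm_mx (umx (c p ^ g)) (umx (x i ^ g)).
  by apply: commute_umx; apply: commute_conjg; exact: xC.
split=> [i k l|i j].
  rewrite ffunE conjgM hE preim_partition_pblockE /= => /eqP dkl.
  (* Indices in different blocks are separated by the eigenvalues of some commutator, which forces
     the entry to vanish. *)
  have [p] : exists p, d (s k) p != d (s l) p.
    apply/existsP; apply/contraT; rewrite negb_exists => /forallP dE.
    by case: dkl; apply/ffunP => p; apply/eqP; rewrite -[_ == _]negbK dE.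
  by rewrite !ffunE; exact: (comm_diag_mx_entry (cgC p i) (cD p)).
rewrite !ffunE -conjRg conjgM; apply/center_block_unitaryP; first by case: aP.
exists (\row_k d (s k) (i, j))%R => [|k l].
  apply/matrixP=> k l; rewrite hE [RHS]mxE [X in (X *+ _)%R]mxE ffunE.
  case: eqVneq => [->|kl]; first by rewrite GRing.mulr1n.
  rewrite GRing.mulr0n; apply: (is_diag_mxP (cD (i, j))).
  by apply: contra kl => /eqP/ord_inj/perm_inj ->.
by rewrite preim_partition_pblockE /= !mxE => /eqP ->.
Qed.

Theorem proposition3 (R : realType) (m n : nat) (hm : 1 <= m) (hn : 1 <= n) :
  let U : groupType := unitary R[i]%C m in
  let B : set {ffun 'I_n -> U} :=
    \bigcup_(a in [set a | ordered_partition a])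
      almost_commuting (block_unitary a) (center (block_unitary a)) in
  B `<=` [set hom_tuple f | f in [set: ghom (free_nil n 3) U]] /\
  [set rep_proj f | f in [set f : ghom (free_nil n 3) U | B (hom_tuple f)]]
    = Rep (free_nil n 3) U.
Proof.
move=> U B; split=> [x [a _ [xa xZ]]|].
  have [|f fx] := @free_nil3_hom_exists n U x.
    by move=> i j k; have [_ zC] := xZ i j; exact: zC.
  by exists f => //; rewrite fx; apply/ffunP=> i; rewrite ffunE.
apply/seteqP; split=> [_ [f _ <-]|_ [f _ <-]]; first by exists f.
(* Conjugating [f] by [g] brings its tuple into [B] without changing its orbit. *)
have [g [a [aP xa]]] := almost_commuting_conj (free_nil3_hom_commute f).
exists (conj_hom f g : ghom _ _); last exact: rep_proj_conj.
exists a => //; congr almost_commuting: xa; apply/ffunP=> i.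
by rewrite !ffunE.
Qed.
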